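(* Let $P$ and $R$ be Markov transition matrices on $S$, where $P$ is irreducible, aperiodic and positive recurrent with unique stationary distribution $\pi_P$, and suppose that the deviation matrix $D_P$ of $P$ exists. Suppose that the series $\pi_P^\top\sum_{k=0}^\infty\bigl((R-P)D_P\bigr)^k$ converges to some finite limit $\mu^\top$, i.e., let $$\mu^\top=\pi_P^\top\sum_{k=0}^\infty\bigl((R-P)D_P\bigr)^k=\pi_P^\top\bigl(I-(R-P)D_P\bigr)^{-1}.$$ (i) If $\mu_i\ge 0$ for all $i\in S$, then $\mu$ is a stationary distribution of $R$. (ii) If $R$ is irreducible and aperiodic and there exists $i\in S$ such that $\|{}_iR\|<1$, then $\mu$ is the unique stationary distribution of $R$, and the bias term $B(R,P)$ is zero.
   Context: $S=\{0,1,\ldots\}\subset\mathbb{N}$ is an at most denumerable (finite or countably infinite) state space. All vectors are column vectors; distributions on $S$ act as row vectors $\mu^\top$. Deviation matrix: $\Pi_P$ is the ergodic projector of $P$, i.e. the matrix all of whose rows equal $\pi_P^\top$, and $D_P=\sum_{k=0}^\infty(P^k-\Pi_P)=(I-P+\Pi_P)^{-1}-\Pi_P$, provided it exists. Taboo matrix: for a transition matrix $R$ and $i\in S$, ${}_iR$ is the matrix obtained from $R$ by setting its $i$-th column to zero. Bias term: $B(R,P)=\lim_{N\to\infty}\pi_R^\top\bigl((R-P)D_P\bigr)^N$ (a row vector), where $\pi_R$ is the stationary distribution of $R$. Norms: for $x\in\mathbb{R}^S$, $\|x\|_\infty=\sup_i|x_i|$, $\|x\|_1=\sum_i|x_i|$,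 and $\|x\|_v=\sup_i|x_i|/v(i)$, where $v(i)=\alpha^i$ for a fixed $\alpha\in[1,\infty)$. Matrices carry the induced norms $\|A\|_\infty=\sup_i\sum_j|A_{ij}|$, $\|A\|_1=\sup_j\sum_i|A_{ij}|$, $\|A\|_v=\sup_i v(i)^{-1}\sum_j|A_{ij}|v(j)$. An unadorned $\|\cdot\|$ means that the result is asserted for any of these norms. *)

(* Defs.v *)
From HB Require Import structures.
From mathcomp Require Import all_boot all_order all_algebra.
From mathcomp Require Import all_classical all_reals all_analysis.

Set Implicit Arguments.
Unset Strict Implicit.
Unset Printing Implicit Defensive.

Import Order.TTheory GRing.Theory Num.Theory.
Import numFieldNormedType.Exports.

Local Open Scope classical_set_scope.
Local Open Scope ring_scope.

(* A state space is an initial segment of nat, {0, ..., n} or all of nat; the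
   coercion [set_type] turns it into the (countable) type of states. *)
Definition state_space (S : set nat) : Prop :=
  S 0%N /\ forall i j : nat, (j <= i)%N -> S i -> S j.

Section Vectors.
Context {R : realType} {S : set nat}.

Definition rvec := S -> R.
Definition mat := S -> S -> R.

(* [esum] is a supremum over finite subsets, hence is the sum of a family only
   when the family is nonnegative.  [tsum f] is the unordered sum of a real
   family; it is meaningful exactly when f is absolutely summable. *)
Definition tsum (f : S -> R) : R :=
  fine (\esum_(i in [set: S]) (Num.max (f i) 0)%:E)
  - fine (\esum_(i in [set: S]) (Num.max (- f i) 0)%:E).

Definition norm1 (x : rvec) : \bar R := \esum_(i in [set: S]) (`|x i|)%:E.

Definition vecm (x : rvec) (A : mat) : rvec :=
  fun j => tsum (fun i => x i * A i j).
Definition mulm (A B : mat) : mat :=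
  fun i j => tsum (fun k => A i k * B k j).
Definition subm (A B : mat) : mat := fun i j => A i j - B i j.
Definition idm : mat := fun i j => (i == j)%:R.
Definition powm (A : mat) (n : nat) : mat := iter n (mulm A) idm.

Definition row_cvg (x : nat -> rvec) (l : rvec) : Prop :=
  norm1 (fun i => x n i - l i) @[n --> \oo] --> 0%E.

Inductive norm_kind := NormInf | NormOne | NormV.

Definition mxnorm (alpha : R) (nk : norm_kind) (A : mat) : \bar R :=
  match nk with
  | NormInf =>
      ereal_sup (range (fun i : S => \esum_(j in [set: S]) (`|A i j|)%:E))
  | NormOne =>
      ereal_sup (range (fun j : S => \esum_(i in [set: S]) (`|A i j|)%:E))
  | NormV =>
      ereal_sup (range (fun i : S =>
        ((alpha ^+ val i)^-1)%:E *
        \esum_(j in [set: S]) (`|A i j| * alpha ^+ val j)%:E)%E)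
  end.

End Vectors.
Arguments rvec : clear implicits.
Arguments mat : clear implicits.

Section MarkovChains.
Context {R : realType} {S : set nat}.
Implicit Types (P Q D : mat R S) (x pi : rvec R S).

Definition is_distribution pi : Prop :=
  (forall i, 0 <= pi i) /\ \esum_(i in [set: S]) (pi i)%:E = 1%E.

Definition is_transition_matrix P : Prop := forall i, is_distribution (P i).

Definition irreducible_mc P : Prop :=
  forall i j : S, exists n, 0 < powm P n i j.

(* The greatest common divisor of the return times to i is 1; this fails, as it
   should, if there is no return time. *)
Definition aperiodic_mc P : Prop :=
  forall (i : S) (d : nat),
    (forall n, (0 < n)%N -> 0 < powm P n i i -> (d %| n)%N) -> d = 1%N.

Definition taboo P (i : S) : mat R S :=
  fun k j => if j == i then 0 else P k j.

(* Probability that the chain started at i returns to i for the first time at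
   time n + 1. *)
Definition first_return P (i : S) (n : nat) : R :=
  mulm (powm (taboo P i) n) P i i.

Definition positive_recurrent P : Prop :=
  forall i : S,
    (\sum_(0 <= n <oo) (first_return P i n)%:E = 1)%E /\
    (\sum_(0 <= n <oo) (n.+1%:R * first_return P i n)%:E < +oo)%E.

Definition is_stationary P pi : Prop :=
  is_distribution pi /\ vecm pi P = pi.

Definition is_unique_stationary P pi : Prop :=
  is_stationary P pi /\ forall nu, is_stationary P nu -> nu = pi.

Definition ergodic_projector pi : mat R S := fun _ j => pi j.

(* Existence of the deviation matrix is entrywise convergence of its series.
   When pi is stationary, entrywise convergence already forces the rows of D to
   be absolutely summable with sum 0 and D (I - P) = I - ergodic_projector pi,
   so no norm bound on D is imposed. *)
Definition is_deviation_matrix P pi D : Prop :=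
  forall i j : S,
    series (fun k => subm (powm P k) (ergodic_projector pi) i j) @ \oo
      --> D i j.

(* The row vector x ((Q - P) D)^n, multiplied out from the left. *)
Definition pert_term Q P D x (n : nat) : rvec R S :=
  iter n (fun y => vecm y (mulm (subm Q P) D)) x.

(* The infinite products in x ((Q - P) D)^n are meaningful for all n: each
   further product y (Q - P) D is an absolutely convergent double sum, so its
   value does not depend on the bracketing. *)
Definition pert_terms_defined Q P D x : Prop :=
  forall (n : nat) (j : S),
    summable [set: S * S] (fun ik : S * S =>
      (pert_term Q P D x n ik.1 * subm Q P ik.1 ik.2 * D ik.2 j)%:E).

(* mu is the sum of the series x ((Q - P) D)^k, k >= 0, with convergence in
   the 1-norm (total variation).  Entrywise, or sup-norm, convergence would not
   do: if every row of P is pi, then D = I - ergodic_projector pi and the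
   partial sums are pi Q^n, which converge to 0 when Q is transient. *)
Definition is_pert_series Q P D x (mu : rvec R S) : Prop :=
  pert_terms_defined Q P D x /\
  row_cvg (fun n i => \sum_(0 <= k < n) pert_term Q P D x k i) mu.

(* b is the bias term B(Q, P), the limit of pi_Q ((Q - P) D)^n. *)
Definition is_bias_term Q P D (piQ b : rvec R S) : Prop :=
  row_cvg (pert_term Q P D piQ) b.

End MarkovChains.

(* Main.v *)
(* Fix a state o and let T be P with column o zeroed. Decomposing at the
   last visit to o and letting N -> oo in the partial sums of the deviation series
   gives D k j - D o j = G k j - m k * pi j, where G = sum_n T^n and m k is the
   expected hitting time of o (finite because the series defining D converges).
   Column o of this identity shows that absolute convergence of z D forces
   sum_k |z k| m k < oo, so for z in l^1 with sum 0 the row y = z D is again in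
   l^1 with sum 0, and y - y P = z. Applied to the terms y_n of the series this
   gives y_{n+1} - y_{n+1} P = y_n (R - P); summing over n, mu = mu R and
   sum mu = 1. If R is irreducible, an l^1 invariant row has constant sign, so
   mu is the unique stationary distribution; the same fact for P shows by
   induction that mu ((R - P) D)^n is mu minus the n-th partial sum of the
   series, which tends to 0. *)
Require Import Defs.
From mathcomp Require Import all_boot all_order all_algebra.
From mathcomp Require Import all_classical all_reals all_analysis.
From mathcomp Require Import ring lra.
Set Implicit Arguments.
Unset Strict Implicit.
Unset Printing Implicit Defensive.

Import Order.TTheory GRing.Theory Num.Theory.
Import numFieldNormedType.Exports.

Local Open Scope classical_set_scope.
Local Open Scope ring_scope.

(** * Unordered sums of absolutely summable real families *)

Section AbsolutelyConvergentSums.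
Context {K : realType} {S : set nat}.
Implicit Types (f g a b : S -> K) (F : S * S -> K).

Definition asum f : Prop := summable [set: S] (fun i => (f i)%:E).

Lemma asum_le f g : (forall i, `|f i| <= g i) -> asum g -> asum f.
Proof.
move=> fg; apply: le_lt_trans; apply: le_esum => i _.
by rewrite /= lee_fin (le_trans (fg i))// ler_norm.
Qed.

Lemma eq_asum f g : f =1 g -> asum f -> asum g.
Proof. by move=> /funext ->. Qed.

Lemma asumD f g : asum f -> asum g -> asum (fun i => f i + g i).
Proof. exact: summableD. Qed.

Lemma asumN f : asum f -> asum (fun i => - f i).
Proof. by rewrite /asum summableN. Qed.

Lemma asumB f g : asum f -> asum g -> asum (fun i => f i - g i).
Proof. by move=> hf /asumN; exact: asumD. Qed.

Lemma asum0 : asum (fun=> 0).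
Proof. by rewrite /asum /summable esum1//= => i _; rewrite normr0. Qed.

Lemma asum_norm f : asum f -> asum (fun i => `|f i|).
Proof.
by apply: le_lt_trans; apply: le_esum => i _ /=; rewrite normr_id.
Qed.

Lemma asum_ge0P f : (forall i, 0 <= f i) ->
  asum f <-> (\esum_(i in [set: S]) (f i)%:E < +oo)%E.
Proof.
move=> f0; rewrite /asum /summable.
by under eq_esum do rewrite /= ger0_norm//.
Qed.

Lemma esum_fin_num f : (forall i, 0 <= f i) -> asum f ->
  \esum_(i in [set: S]) (f i)%:E \is a fin_num.
Proof.
by move=> f0; rewrite /asum summableE; under eq_esum do rewrite /= ger0_norm//.
Qed.

(** [tsum] is defined through positive and negative parts; [esumB] shows that any other nonnegative
    splitting gives the same value, which is what additivity requires. *)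
Lemma tsum_sub a b : (forall i, 0 <= a i) -> (forall i, 0 <= b i) ->
  asum a -> asum b -> tsum (fun i => a i - b i) =
  fine (\esum_(i in [set: S]) (a i)%:E) - fine (\esum_(i in [set: S]) (b i)%:E).
Proof.
move=> a0 b0 ha hb.
have h := esumB ha hb (fun i _ => a0 i) (fun i _ => b0 i).
have hab := asumB ha hb.
have fp : \esum_(i in [set: S]) (a i)%:E \is a fin_num by exact: esum_fin_num.
have fn : \esum_(i in [set: S]) (b i)%:E \is a fin_num by exact: esum_fin_num.
rewrite -fineB// -h fineB.
- by rewrite /tsum; congr (fine _ - fine _); apply: eq_esum => i _;
  rewrite ?funeposE ?funenegE /= EFin_max.
- have /summable_funepos : summable [set: S] (fun i => (a i - b i)%:E) by [].
  by rewrite summableE; under eq_esum do rewrite gee0_abs//.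
- have /summable_funeneg : summable [set: S] (fun i => (a i - b i)%:E) by [].
  by rewrite summableE; under eq_esum do rewrite gee0_abs//.
Qed.

Lemma tsum_ge0E f : (forall i, 0 <= f i) -> asum f ->
  (tsum f)%:E = \esum_(i in [set: S]) (f i)%:E.
Proof.
move=> f0 hf; have := tsum_sub f0 (fun=> lexx 0) hf asum0.
rewrite (@esum1 _ _ setT (fun=> 0%:E))//= subr0.
under eq_fun do rewrite subr0.
move=> ->; rewrite fineK//; exact: esum_fin_num.
Qed.

Lemma tsum_esum f (r : \bar K) : (forall i, 0 <= f i) -> r \is a fin_num ->
  \esum_(i in [set: S]) (f i)%:E = r -> asum f /\ tsum f = fine r.
Proof.
move=> f0 fr hr.
have hf : asum f by apply/asum_ge0P => //; rewrite hr ltey_eq fr.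
by split=> //; rewrite -hr -tsum_ge0E.
Qed.

Lemma tsum_subE a b : (forall i, 0 <= a i) -> (forall i, 0 <= b i) ->
  asum a -> asum b -> tsum (fun i => a i - b i) = tsum a - tsum b.
Proof.
by move=> a0 b0 ha hb; rewrite tsum_sub// -!tsum_ge0E.
Qed.

Lemma asum_pos f : asum f -> asum (fun i => Num.max (f i) 0).
Proof.
move=> /asum_norm; apply: asum_le => i; rewrite ger0_norm ?le_max ?lexx ?orbT//.
by rewrite ge_max ler_norm normr_ge0.
Qed.

Lemma maxr_sub (x : K) : x = Num.max x 0 - Num.max (- x) 0.
Proof. by rewrite /Num.max; do 2!case: ltP => ?; lra. Qed.

Lemma tsumN f : tsum (fun i => - f i) = - tsum f.
Proof.
rewrite /tsum opprB; congr (_ - _).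
by under eq_esum do rewrite opprK.
Qed.

Lemma tsum0 : tsum (fun _ : S => 0 : K) = 0.
Proof. by rewrite /tsum oppr0 subrr. Qed.

Lemma asum_delta (o : S) f : (forall i, i != o -> f i = 0) ->
  asum f /\ tsum f = f o.
Proof.
move=> f0.
have E (g : S -> K) : (forall i, 0 <= g i) -> (forall i, i != o -> g i = 0) ->
    \esum_(i in [set: S]) (g i)%:E = (g o)%:E.
  move=> g0 gE; rewrite (esumID [set o]); last by move=> i; rewrite lee_fin.
  rewrite setTI esum_set1 ?lee_fin// esum1 ?adde0// => i [_ /eqP io].
  by rewrite gE.
split.
  rewrite /asum /summable E ?ltry//= => i io.
  by rewrite f0// normr0.
rewrite /tsum !E; first by rewrite /= [RHS]maxr_sub.
all: by move=> i *; rewrite ?le_max ?lexx ?orbT ?f0 ?oppr0 ?maxxx.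
Qed.

Local Opaque tsum.

Lemma tsumD_ge0 a b : (forall i, 0 <= a i) -> (forall i, 0 <= b i) ->
  asum a -> asum b -> tsum (fun i => a i + b i) = tsum a + tsum b.
Proof.
move=> a0 b0 ha hb; apply: EFin_inj; rewrite [RHS]EFinD !tsum_ge0E//.
- by rewrite -esumD// => i _; rewrite lee_fin.
- by move=> i; apply: addr_ge0.
- exact: asumD.
Qed.

Lemma tsumD f g : asum f -> asum g ->
  tsum (fun i => f i + g i) = tsum f + tsum g.
Proof.
move=> hf hg.
pose p (h : S -> K) := fun i => Num.max (h i) 0.
pose n (h : S -> K) := fun i => Num.max (- h i) 0.
have p0 h i : 0 <= p h i by rewrite le_max lexx orbT.
have n0 h i : 0 <= n h i by rewrite le_max lexx orbT.
have hp h : asum h -> asum (p h) by exact: asum_pos.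
have hn h : asum h -> asum (n h) by move=> /asumN/asum_pos.
have E h : asum h -> tsum h = tsum (p h) - tsum (n h).
  move=> hh; rewrite -tsum_subE//; [|exact: hp|exact: hn].
  by congr tsum; apply/funext => i; exact: maxr_sub.
(* The parts of [f + g] are not the sums of the parts of [f] and [g], but these sums still split
   [f + g], which suffices for [tsum_subE]. *)
have -> : (fun i => f i + g i) =
    (fun i => (p f i + p g i) - (n f i + n g i)).
  by apply/funext => i; rewrite {1}(maxr_sub (f i)) {1}(maxr_sub (g i))
    /p /n; ring.
have sum0 (u v : S -> K) : (forall i, 0 <= u i) -> (forall i, 0 <= v i) ->
  forall i, 0 <= u i + v i by move=> u0 v0 i; apply: addr_ge0.
have [hpf hpg hnf hng] := And4 (hp f hf) (hp g hg) (hn f hf) (hn g hg).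
rewrite (tsum_subE (sum0 _ _ (p0 f) (p0 g)) (sum0 _ _ (n0 f) (n0 g))
  (asumD hpf hpg) (asumD hnf hng)).
by rewrite !tsumD_ge0// (E f hf) (E g hg) opprD addrACA.
Qed.

Lemma tsumB f g : asum f -> asum g ->
  tsum (fun i => f i - g i) = tsum f - tsum g.
Proof. by move=> hf hg; rewrite tsumD ?tsumN//; exact: asumN. Qed.

Lemma tsum_ge0 f : (forall i, 0 <= f i) -> asum f -> 0 <= tsum f.
Proof.
move=> f0 hf; rewrite -lee_fin tsum_ge0E//; apply: esum_ge0 => i _.
by rewrite lee_fin.
Qed.

Lemma ler_tsum f g : asum f -> asum g -> (forall i, f i <= g i) ->
  tsum f <= tsum g.
Proof.
move=> hf hg fg; rewrite -subr_ge0 -tsumB//; apply: tsum_ge0; last exact: asumB.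
by move=> i; rewrite subr_ge0.
Qed.

Lemma ler_norm_tsum f : asum f -> `|tsum f| <= tsum (fun i => `|f i|).
Proof.
move=> hf; have hn := asum_norm hf; rewrite ler_norml -tsumN !ler_tsum//.
- by move=> i; exact: ler_norm.
- exact: asumN.
- by move=> i; rewrite lerNl -normrN ler_norm.
Qed.

Lemma le_tsum_term f i : (forall i, 0 <= f i) -> asum f -> f i <= tsum f.
Proof.
move=> f0 hf; rewrite -lee_fin tsum_ge0E// (esumID [set i])//; last first.
  by move=> j _; rewrite lee_fin.
rewrite setTI esum_set1 ?lee_fin// leeDl//.
by apply: esum_ge0 => j _; rewrite lee_fin.
Qed.

Lemma tsum_eq0 f i : (forall i, 0 <= f i) -> asum f -> tsum f = 0 -> f i = 0.
Proof.
move=> f0 hf h0; apply/eqP; rewrite eq_le f0 andbT -h0; exact: le_tsum_term.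
Qed.


(** Checked on finite subsets; the converse for [c > 0] comes later from the same inequality applied
    to [c^-1]. *)
Lemma le_esumZ (c : K) f : 0 <= c -> (forall i, 0 <= f i) ->
  (\esum_(i in [set: S]) (c * f i)%:E <=
   c%:E * \esum_(i in [set: S]) (f i)%:E)%E.
Proof.
move=> c0 f0; apply: ge_ereal_sup => _ [X hX <-].
under eq_fsbigr do rewrite EFinM.
rewrite -ge0_mule_fsumr; last by move=> i; rewrite lee_fin.
by rewrite lee_wpmul2l ?lee_fin//; apply: ereal_sup_ubound; exists X.
Qed.

Lemma asumZ (c : K) f : asum f -> asum (fun i => c * f i).
Proof.
move=> hf; apply: (@asum_le _ (fun i => `|c| * `|f i|)).
  by move=> i; rewrite normrM.
apply/asum_ge0P; first by move=> i; rewrite mulr_ge0.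
apply: le_lt_trans (le_esumZ _ _) _ => //.
by rewrite -(tsum_ge0E (fun=> normr_ge0 _) (asum_norm hf)) -EFinM ltry.
Qed.

Lemma tsumZ_ge0 (c : K) f : 0 <= c -> (forall i, 0 <= f i) -> asum f ->
  tsum (fun i => c * f i) = c * tsum f.
Proof.
move=> c0 f0 hf; apply/eqP; rewrite eq_le; apply/andP; split.
  rewrite -lee_fin [leRHS]EFinM !tsum_ge0E ?le_esumZ//; last exact: asumZ.
  by move=> i; rewrite mulr_ge0.
have [->|cn0] := eqVneq c 0.
  by rewrite mul0r; under eq_fun do rewrite mul0r; rewrite tsum0.
have {cn0}c0 : 0 < c by rewrite lt_neqAle eq_sym cn0.
rewrite mulrC -ler_pdivlMr// mulrC.
have cf0 i : 0 <= c * f i by rewrite mulr_ge0// ltW.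
have ci : 0 <= c^-1 by rewrite invr_ge0 ltW.
rewrite -lee_fin [leRHS]EFinM !tsum_ge0E//; last exact: asumZ.
apply: le_trans (le_esumZ ci cf0).
by apply: le_esum => i _; rewrite mulKf// gt_eqF.
Qed.

Lemma tsumZ (c : K) f : asum f -> tsum (fun i => c * f i) = c * tsum f.
Proof.
move=> hf; wlog c0 : c / 0 <= c.
  move=> hw; have [|/ltW c0] := leP 0 c; first exact: hw.
  have := hw (- c); rewrite oppr_ge0 => /(_ c0).
  under eq_fun do rewrite mulNr.
  by rewrite tsumN mulNr => /oppr_inj.
have hp := asum_pos hf; have hn := asum_pos (asumN hf).
have E : f = (fun i => Num.max (f i) 0 - Num.max (- f i) 0).
  by apply/funext => i; exact: maxr_sub.
have p0 (x : K) : 0 <= Num.max x 0 by rewrite le_max lexx orbT.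
rewrite {2}E tsum_subE// {1}E; under eq_fun do rewrite mulrBr.
rewrite tsum_subE ?tsumZ_ge0// ?mulrBr//; try (by move=> i; rewrite mulr_ge0);
exact: asumZ.
Qed.

Lemma tsum_sum (N : nat) (F : nat -> S -> K) : (forall n, asum (F n)) ->
  asum (fun i => \sum_(0 <= n < N) F n i) /\
  tsum (fun i => \sum_(0 <= n < N) F n i) = \sum_(0 <= n < N) tsum (F n).
Proof.
move=> hF; elim: N => [|N [h1 h2]].
  under eq_fun do rewrite big_nil.
  by rewrite big_nil tsum0; split=> //; exact: asum0.
under eq_fun do rewrite big_nat_recr//=.
by rewrite big_nat_recr//= tsumD// h2; split=> //; exact: asumD.
Qed.

(** * Double families, Tonelli and Fubini *)

Definition asum2 F : Prop :=
  summable [set: S * S] (fun p => (F p)%:E).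

Lemma esum_pair F : (forall p, 0 <= F p) ->
  \esum_(i in [set: S]) \esum_(j in [set: S]) (F (i, j))%:E =
  \esum_(p in [set: S * S]) (F p)%:E.
Proof.
move=> F0; rewrite (@esum_esum _ _ _ _ (fun=> setT) (fun i j => (F (i, j))%:E))//.
  rewrite (_ : _ `*`` _ = setT); last by apply/seteqP; split.
  by apply: eq_esum => -[].
by move=> *; rewrite lee_fin.
Qed.

Lemma esum_swap F : (forall p, 0 <= F p) ->
  \esum_(p in [set: S * S]) (F p)%:E =
  \esum_(p in [set: S * S]) (F (p.2, p.1))%:E.
Proof.
move=> F0; apply: (@reindex_esum _ _ _ _ _ (fun p : S * S => (p.2, p.1))).
split=> //.
- by move=> [a b] [c d] _ _ /= [-> ->].
- by move=> [a b] _; exists (b, a).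
Qed.

Lemma asum2_row F i : asum2 F -> asum (fun j => F (i, j)).
Proof.
rewrite /asum2 /asum /summable -(@esum_pair (fun p => `|F p|))//= => h.
have := @summable_pinfty _ _ setT
  (fun i => \esum_(j in [set: S]) (`|F (i, j)|)%:E).
rewrite /summable; under eq_esum => k _.
  rewrite gee0_abs; last by apply: esum_ge0 => j _; rewrite lee_fin.
  over.
move=> /(_ h i Logic.I); rewrite gee0_abs//.
by apply: esum_ge0 => j _; rewrite lee_fin.
Qed.

Lemma asum2_swap F : asum2 F -> asum2 (fun p => F (p.2, p.1)).
Proof.
by rewrite /asum2 /summable (@esum_swap (fun p => `|F p|)).
Qed.

Lemma tsum_pair_ge0 F : (forall p, 0 <= F p) -> asum2 F ->
  asum (fun i => tsum (fun j => F (i, j))) /\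
  (tsum (fun i => tsum (fun j => F (i, j))))%:E =
    \esum_(p in [set: S * S]) (F p)%:E.
Proof.
move=> F0 hF; have hr i := asum2_row i hF.
have r0 i : 0 <= tsum (fun j => F (i, j)) by apply: tsum_ge0.
have E : \esum_(i in [set: S]) (tsum (fun j => F (i, j)))%:E =
    \esum_(p in [set: S * S]) (F p)%:E.
  by rewrite -esum_pair//; apply: eq_esum => i _; rewrite tsum_ge0E.
have hs : asum (fun i => tsum (fun j => F (i, j))).
  apply/asum_ge0P => //; rewrite E; move: hF; rewrite /asum2 /summable.
  by under eq_esum do rewrite /= ger0_norm//.
by rewrite tsum_ge0E.
Qed.

(** Tonelli for the positive and negative parts separately; the two orders agree because swapping
    coordinates permutes [S * S]. *)
Lemma tsum_fubini F : asum2 F ->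
  asum (fun i => tsum (fun j => F (i, j))) /\
  tsum (fun i => tsum (fun j => F (i, j))) =
  tsum (fun j => tsum (fun i => F (i, j))).
Proof.
move=> hF.
pose p q := Num.max (F q) 0; pose n q := Num.max (- F q) 0.
have p0 q : 0 <= p q by rewrite le_max lexx orbT.
have n0 q : 0 <= n q by rewrite le_max lexx orbT.
have hp : asum2 p.
  apply: le_lt_trans hF; apply: le_esum => q _.
  by rewrite /= lee_fin ger0_norm// ge_max ler_norm normr_ge0.
have hn : asum2 n.
  apply: le_lt_trans hF; apply: le_esum => q _.
  by rewrite /= lee_fin ger0_norm// ge_max -normrN ler_norm normr_ge0.
have hp' := asum2_swap hp; have hn' := asum2_swap hn.
have rE i : tsum (fun j => F (i, j)) =
    tsum (fun j => p (i, j)) - tsum (fun j => n (i, j)).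
  rewrite -tsumB; [|exact: asum2_row..].
  by congr tsum; apply/funext => j; exact: maxr_sub.
have cE j : tsum (fun i => F (i, j)) =
    tsum (fun i => p (i, j)) - tsum (fun i => n (i, j)).
  rewrite -tsumB; [|exact: (asum2_row j hp')|exact: (asum2_row j hn')].
  by congr tsum; apply/funext => i; exact: maxr_sub.
have [P1 P2] := tsum_pair_ge0 p0 hp.
have [N1 N2] := tsum_pair_ge0 n0 hn.
have [P1' P2'] := tsum_pair_ge0 (fun=> p0 _) hp'.
have [N1' N2'] := tsum_pair_ge0 (fun=> n0 _) hn'.
under eq_fun do rewrite rE.
split; first exact: asumB.
under [in RHS]eq_fun do rewrite cE.
move: P1' P2' N1' N2' => /= P1' P2' N1' N2'.
rewrite (tsumB P1 N1) (tsumB P1' N1'); congr (_ - _); apply: EFin_inj.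
  by rewrite P2 P2' -esum_swap.
by rewrite N2 N2' -esum_swap.
Qed.

Lemma asum2_intro F : (forall i, asum (fun j => F (i, j))) ->
  asum (fun i => tsum (fun j => `|F (i, j)|)) -> asum2 F.
Proof.
move=> hr hs; rewrite /asum2 /summable -(@esum_pair (fun p => `|F p|))//=.
under eq_esum => i _.
  rewrite -(tsum_ge0E (fun=> normr_ge0 _) (asum_norm (hr i))).
  over.
have r0 i : 0 <= tsum (fun j => `|F (i, j)|).
  by apply: tsum_ge0 => //; exact/asum_norm.
exact: (iffLR (asum_ge0P r0) hs).
Qed.

Lemma asum2_le F (H : S * S -> K) :
  (forall p, `|F p| <= `|H p|) -> asum2 H -> asum2 F.
Proof.
by move=> FH; apply: le_lt_trans; apply: le_esum => p _; rewrite /= lee_fin.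
Qed.

Lemma asumM f g c : asum f -> (forall i, `|g i| <= c) ->
  asum (fun i => f i * g i).
Proof.
move=> hf gc; apply: (@asum_le _ (fun i => c * `|f i|)).
  by move=> i; rewrite normrM mulrC ler_wpM2r.
exact/asumZ/asum_norm.
Qed.

End AbsolutelyConvergentSums.

Local Opaque tsum.

(** * Limits of convolutions, and exchange of series with unordered sums *)

Section Convergence.
Context {K : realType}.

(** Subtracting [l] leaves a convolution of [t] with a bounded null sequence. Split it at a fixed
    [M]: in the head the indices [N - m.+1] are large once [N] is, and in the tail the mass of [t]
    is small. *)
Lemma cvg_convolution (t a : nat -> K) (s l B : K) :
  (forall n, 0 <= t n) -> series t @ \oo --> s ->
  (forall n, `|a n| <= B) -> a @ \oo --> l ->
  (fun N => \sum_(0 <= m < N) t m * a (N - m.+1)%N) @ \oo --> s * l.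
Proof.
move=> t0 ts aB al.
have s0 n : series t n <= s.
  rewrite -(cvg_lim (@Rhausdorff K) ts); apply: nondecreasing_cvgn_le.
    by apply/nondecreasing_series => k _ _.
  by apply/cvg_ex; exists s.
have sge0 : 0 <= s by apply: le_trans (s0 0%N); rewrite /series/= big_nil.
have B0 : 0 <= B by apply: le_trans (aB 0%N).
pose C := B + `|l|.
have C0 : 0 <= C by rewrite addr_ge0.
have bC n : `|a n - l| <= C by rewrite (le_trans (ler_normB _ _))// lerD2r.
suff h0 : (fun N => \sum_(0 <= m < N) t m * (a (N - m.+1)%N - l)) @ \oo --> 0.
  have -> : (fun N => \sum_(0 <= m < N) t m * a (N - m.+1)%N) =
      (fun N => \sum_(0 <= m < N) t m * (a (N - m.+1)%N - l) + series t N * l).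
    apply/funext => N; rewrite /series/= mulr_suml -big_split/=.
    by apply: eq_bigr => m _; rewrite mulrBr subrK.
  by rewrite -[X in _ --> X]add0r; apply: cvgD => //; apply: cvgMl.
apply/cvgrPdist_le => /= e e0.
(* Head and tail contribute at most [s * d] and [d * C]; the extra 1 keeps the denominator
   positive. *)
pose d := e / (s + C + 1).
have d0 : 0 < d by rewrite divr_gt0// ltr_wpDl// addr_ge0.
have [M _ hM] : \forall n \near \oo, `|s - series t n| <= d.
  by move/cvgrPdist_le : ts; apply.
have [n0 _ hn0] : \forall n \near \oo, `|l - a n| <= d.
  by move/cvgrPdist_le : al; apply.
(* The bound [M + n0] makes [N - m.+1] at least [n0] for every [m < M]. *)
exists (M + n0)%N => // N /= MN; rewrite sub0r normrN.
have leMN : (M <= N)%N by apply: leq_trans MN; exact: leq_addr.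
rewrite (big_cat_nat (n := M))//= (le_trans (ler_normD _ _))//.
have h1 : `|\sum_(0 <= m < M) t m * (a (N - m.+1)%N - l)| <= s * d.
  apply: le_trans (ler_norm_sum _ _ _) _.
  apply: (@le_trans _ _ (series t M * d)); last by rewrite ler_wpM2r// ltW.
  rewrite /series/= mulr_suml; rewrite big_nat_cond [leRHS]big_nat_cond.
  apply: ler_sum => m /andP[/andP[_ mM] _].
  rewrite normrM ger0_norm// ler_wpM2l// distrC hn0//= leq_subRL; last first.
    by apply: leq_trans mM leMN.
  by apply: leq_trans MN; rewrite leq_add2r.
have h2 : `|\sum_(M <= m < N) t m * (a (N - m.+1)%N - l)| <= d * C.
  apply: le_trans (ler_norm_sum _ _ _) _.
  apply: (@le_trans _ _ ((series t N - series t M) * C)); last first.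
    rewrite ler_wpM2r//; have := hM M (leqnn _); have := s0 N.
    by have := ler_norm (s - series t M); lra.
  rewrite sub_series_geq// mulr_suml; apply: ler_sum => m _.
  by rewrite normrM ger0_norm// ler_wpM2l.
apply: le_trans (lerD h1 h2) _.
rewrite [s * d]mulrC -mulrDr /d -mulrA ler_piMr ?(ltW e0)// mulrC ler_pdivrMr.
  by rewrite mul1r lerDl.
by rewrite ltr_wpDl// addr_ge0.
Qed.

Lemma esum_exchange (T1 T2 : choiceType) (F : T1 -> T2 -> \bar K) :
  (forall i j, 0 <= F i j)%E ->
  \esum_(i in [set: T1]) \esum_(j in [set: T2]) F i j =
  \esum_(j in [set: T2]) \esum_(i in [set: T1]) F i j.
Proof.
move=> F0; rewrite (@esum_esum _ _ _ _ (fun=> setT) F)//.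
rewrite (@esum_esum _ _ _ _ (fun=> setT) (fun j i => F i j))//.
apply: (@reindex_esum _ _ _ _ _ (fun p : T2 * T1 => (p.2, p.1))
  (fun p => F p.1 p.2)).
split=> //.
- by move=> [a b] [c d] _ _ /= [-> ->].
- by move=> [a b] _; exists (b, a).
Qed.

Lemma series_esum (f : nat -> K) (s : K) : (forall n, 0 <= f n) ->
  series f @ \oo --> s -> \esum_(n in [set: nat]) (f n)%:E = s%:E.
Proof.
move=> f0 fs; rewrite -nneseries_esumT; last by move=> n; rewrite lee_fin.
apply/cvg_lim => //.
rewrite (_ : (fun n => _) = EFin \o series f).
  by apply: cvg_EFin => //; exact: nearW.
by apply/funext => n /=; rewrite sumEFin.
Qed.

(** Monotone convergence: both sides are iterated sums of one nonnegative family, so finiteness of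
    one order yields summability of [g]. *)
Lemma tsum_series (S : set nat) (f : nat -> S -> K) (g : S -> K) (s : K) :
  (forall n i, 0 <= f n i) -> (forall n, asum (f n)) ->
  (forall i, series (fun n => f n i) @ \oo --> g i) ->
  series (fun n => tsum (f n)) @ \oo --> s ->
  [/\ forall i, 0 <= g i, asum g & tsum g = s].
Proof.
move=> f0 hf fg fs.
have E : \esum_(i in [set: S]) (g i)%:E = s%:E.
  rewrite -(series_esum _ fs); last by move=> n; exact: tsum_ge0.
  under eq_esum => i _ do rewrite -(series_esum (fun n => f0 n i) (fg i)).
  rewrite esum_exchange; last by move=> *; rewrite lee_fin.
  by apply: eq_esum => n _; rewrite -tsum_ge0E.
have g0 i : 0 <= g i.
  rewrite -lee_fin -(series_esum (fun n => f0 n i) (fg i)).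
  by apply: esum_ge0 => n _; rewrite lee_fin.
have [|h1 h2] := tsum_esum g0 _ E; first by [].
by split.
Qed.

End Convergence.

(** * Substochastic matrices acting on absolutely summable rows *)

Section Matrices.
Context {K : realType} {S : set nat}.
Implicit Types (A B P : mat K S) (x y : rvec K S).

(** Asking for row sums at most 1 keeps taboo matrices, whose rows lose mass, and their powers in
    the same class as transition matrices. *)
Definition substochastic A : Prop :=
  (forall i j, 0 <= A i j) /\ forall i, asum (A i) /\ tsum (A i) <= 1.

Lemma distribution_tsum x : is_distribution x -> asum x /\ tsum x = 1.
Proof. by move=> [x0 /(tsum_esum x0)]; exact. Qed.

Lemma transition_substochastic P : is_transition_matrix P -> substochastic P.
Proof.
move=> hP; split=> [i j|i]; first by have [] := hP i.
by have [h ->] := distribution_tsum (hP i).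
Qed.

Lemma substochastic_le1 A : substochastic A -> forall i j, `|A i j| <= 1.
Proof.
move=> [A0 hA] i j; have [h h1] := hA i.
by rewrite ger0_norm// (le_trans _ h1)// le_tsum_term.
Qed.

Lemma vecm_asum x A : asum x -> substochastic A ->
  forall j, asum (fun i => x i * A i j).
Proof.
by move=> hx hA j; apply: (asumM hx) => i; exact: substochastic_le1.
Qed.

(** The double sum of [|x i| * A i j] is at most the 1-norm of [x]; this licenses interchanging sums
    in products with [A]. *)
Lemma vecm_asum2 x A : asum x -> substochastic A ->
  asum2 (fun p => x p.1 * A p.1 p.2).
Proof.
move=> hx [A0 hA]; apply: asum2_intro => /= [i|].
  by apply: asumZ; have [] := hA i.
apply: asum_le (asum_norm hx) => i.
have [h1 h2] := hA i.
under eq_fun do rewrite normrM [`|A _ _|]ger0_norm//.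
rewrite tsumZ// normrM normr_id ler_piMr// ger0_norm//.
exact: tsum_ge0.
Qed.

Lemma asum_vecm x A : asum x -> substochastic A -> asum (vecm x A).
Proof.
move=> hx hA.
by have [] := tsum_fubini (asum2_swap (vecm_asum2 hx hA)).
Qed.

Lemma tsum_vecm x A : asum x -> substochastic A ->
  tsum (vecm x A) = tsum (fun i => x i * tsum (A i)).
Proof.
move=> hx hA.
have [_ /= <-] := tsum_fubini (vecm_asum2 hx hA).
by congr tsum; apply/funext => i; rewrite tsumZ//; have [] := hA.2 i.
Qed.

Lemma tsum_vecm_transition x P : asum x -> is_transition_matrix P ->
  tsum (vecm x P) = tsum x.
Proof.
move=> hx hP; rewrite tsum_vecm//; last exact: transition_substochastic.
congr tsum; apply/funext => i.
by have [_ ->] := distribution_tsum (hP i); rewrite mulr1.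
Qed.

Lemma vecmB x y A : asum x -> asum y -> substochastic A ->
  vecm (fun i => x i - y i) A = (fun i => vecm x A i - vecm y A i).
Proof.
move=> hx hy hA; apply/funext => j; rewrite /vecm -tsumB; try exact: vecm_asum.
by congr tsum; apply/funext => i; rewrite mulrBl.
Qed.

Lemma mulm_row A B i : mulm A B i = vecm (A i) B.
Proof. by []. Qed.

Lemma vecmA x A B : asum x -> substochastic A -> substochastic B ->
  vecm (vecm x A) B = vecm x (mulm A B).
Proof.
move=> hx hA hB; apply/funext => j.
have hF : asum2 (fun p : S * S => x p.1 * A p.1 p.2 * B p.2 j).
  apply: asum2_le (vecm_asum2 hx hA) => p.
  by rewrite normrM ler_piMr// substochastic_le1.
have [_ /= E] := tsum_fubini hF.
transitivity (tsum (fun k => tsum (fun i => x i * A i k * B k j))).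
  congr tsum; apply/funext => k; rewrite mulrC /vecm -tsumZ; last first.
    exact: vecm_asum.
  by congr tsum; apply/funext => i; rewrite mulrC.
rewrite -E; congr tsum; apply/funext => i; rewrite /mulm -tsumZ.
  by congr tsum; apply/funext => k; rewrite mulrA.
by apply: vecm_asum => //; have [] := hA.2 i.
Qed.

Lemma substochastic_idm : substochastic (@idm K S).
Proof.
split=> [i j|i]; first exact: ler0n.
have [|h1 h2] := @asum_delta K S i (idm i).
  by move=> j; rewrite /idm eq_sym => /negbTE ->.
by rewrite h2 /idm eqxx.
Qed.

Lemma tsum_idm i : tsum (@idm K S i) = 1.
Proof.
have [|_ ->] := @asum_delta K S i (idm i).
  by move=> j; rewrite /idm eq_sym => /negbTE ->.
by rewrite /idm eqxx.
Qed.

Lemma vecm_idm x : vecm x (@idm K S) = x.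
Proof.
apply/funext => j; rewrite /vecm.
have [|_ ->] := @asum_delta K S j (fun i => x i * idm i j).
  by move=> i /negbTE ij; rewrite /idm ij mulr0.
by rewrite /idm eqxx mulr1.
Qed.

Lemma idm_vecm A i : vecm (@idm K S i) A = A i.
Proof.
apply/funext => j; rewrite /vecm.
have [|_ ->] := @asum_delta K S i (fun k => idm i k * A k j).
  by move=> k; rewrite /idm eq_sym => /negbTE ->; rewrite mul0r.
by rewrite /idm eqxx mul1r.
Qed.

Lemma substochastic_mulm A B :
  substochastic A -> substochastic B -> substochastic (mulm A B).
Proof.
move=> hA hB; split=> [i j|i].
  apply: tsum_ge0 => [k|]; first by rewrite mulr_ge0//; [apply hA.1|apply hB.1].
  by apply: vecm_asum => //; have [] := hA.2 i.
have [h1 h2] := hA.2 i.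
rewrite mulm_row tsum_vecm//; split; first exact: asum_vecm.
apply: le_trans h2; apply: ler_tsum => //.
  apply: (@asumM _ _ _ _ 1) => // k; have [? ?] := hB.2 k.
  by rewrite ger0_norm// tsum_ge0//; exact: hB.1.
by move=> k; rewrite ler_piMr//; [exact: hA.1|have [] := hB.2 k].
Qed.

Lemma substochastic_powm A n : substochastic A -> substochastic (powm A n).
Proof.
move=> hA; elim: n => [|n IH]; first exact: substochastic_idm.
exact: substochastic_mulm.
Qed.

(** [powm] multiplies on the left; the other order rests on associativity, which for infinite
    matrices is Fubini. *)
Lemma powmSr A n : substochastic A -> powm A n.+1 = mulm (powm A n) A.
Proof.
move=> hA; apply/funext => i; elim: n i => [|n IH] i.
  by rewrite /powm/= !mulm_row vecm_idm idm_vecm.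
rewrite mulm_row [in RHS]/powm iterS -/(powm A n) !mulm_row.
rewrite vecmA//; [|by have [] := hA.2 i|exact: substochastic_powm].
by congr vecm; apply/funext => k; exact: IH.
Qed.

End Matrices.

(** * Summable invariant rows of irreducible matrices *)

Section Invariant.
Context {K : realType} {S : set nat}.
Implicit Types (P Q : mat K S) (x u : rvec K S).

(** Induction on the length of a path of positive probability from [i] to [j]: invariance carries
    the mass at [i] to the next state of the path. *)
Lemma invariant_gt0 Q u : substochastic Q -> asum u -> (forall i, 0 <= u i) ->
  vecm u Q = u -> irreducible_mc Q -> forall i j, 0 < u i -> 0 < u j.
Proof.
move=> hQ hu u0 uQ irr i j; have [n] := irr i j.
elim: n i => [|n IH] i.
  by rewrite /powm/= /idm; have [->|] := eqVneq i j => //; rewrite ltxx.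
rewrite /powm iterS -/(powm Q n) => h ui.
have [k hk] : exists k, Q i k * powm Q n k j != 0.
  apply: contrapT => /forallNP h0; move: h.
  rewrite /mulm (_ : (fun k => _) = fun=> 0) ?tsum0 ?ltxx//.
  by apply/funext => k; apply/eqP/negP => /negP; exact: h0.
have Qn := substochastic_powm n hQ.
have := hk; rewrite mulf_eq0 negb_or => /andP[Qik Qkj].
apply: (IH k); first by rewrite lt_neqAle eq_sym Qkj Qn.1.
rewrite -uQ; apply: (@lt_le_trans _ _ (u i * Q i k)).
  by rewrite mulr_gt0// lt_neqAle eq_sym Qik hQ.1.
apply: (le_tsum_term i (f := fun i => u i * Q i k)); last exact: vecm_asum.
by move=> l; rewrite mulr_ge0// hQ.1.
Qed.

(* If [x = x Q] then [|x| <= |x| Q] with equal sums, so [|x|], [|x| + x] and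
   [|x| - x] are invariant too; the last two cannot both be positive. *)
Lemma invariant_sign Q x : is_transition_matrix Q -> irreducible_mc Q ->
  asum x -> vecm x Q = x ->
  (forall i, 0 <= x i) \/ (forall i, x i <= 0).
Proof.
move=> hQ irr hx xQ.
have sQ := transition_substochastic hQ.
pose a := fun i => `|x i|.
have ha : asum a by exact: asum_norm.
have haQ := asum_vecm ha sQ.
have a_le j : a j <= vecm a Q j.
  rewrite /a -{1}xQ /vecm; apply: le_trans (ler_norm_tsum _) _.
    exact: vecm_asum.
  rewrite le_eqVlt; apply/orP; left; apply/eqP; congr tsum.
  by apply/funext => i; rewrite normrM [`|Q _ _|]ger0_norm// sQ.1.
have aQ : vecm a Q = a.
  apply/funext => j; apply/eqP; rewrite -subr_eq0; apply/eqP.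
  apply: (@tsum_eq0 _ _ (fun j => vecm a Q j - a j)).
  - by move=> i; rewrite subr_ge0.
  - exact: asumB.
  - by rewrite tsumB// tsum_vecm_transition// subrr.
have uQ (s : rvec K S) : asum s -> vecm s Q = s ->
    vecm (fun i => a i - s i) Q = (fun i => a i - s i).
  by move=> hs sE; rewrite vecmB// aQ sE.
have hNx := asumN hx.
have NxQ : vecm (fun i => - x i) Q = (fun i => - x i).
  rewrite -[in RHS]xQ; apply/funext => j; rewrite /vecm -tsumN.
  by congr tsum; apply/funext => i; rewrite mulNr.
have v0 i : 0 <= a i - x i by rewrite subr_ge0 ler_norm.
have u0 i : 0 <= a i - - x i by rewrite subr_ge0 /a -normrN ler_norm.
have [[i xi]|/forallNP xn] := pselect (exists i, 0 < x i); [left|right] => j;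
  last by rewrite leNgt; exact/negP/xn.
have uj : 0 < a j - - x j.
  apply: (invariant_gt0 sQ (asumB ha hNx) u0 (uQ _ hNx NxQ) irr (i := i)).
  by rewrite opprK /a ltr_wpDl.
have [//|xj] := leP 0 (x j).
by move: uj; rewrite /a ltr0_norm// opprK addNr ltxx.
Qed.

(** The row has constant sign by [invariant_sign], and a summable row of constant sign with sum 0
    vanishes. *)
Lemma invariant_eq0 Q x : is_transition_matrix Q -> irreducible_mc Q ->
  asum x -> vecm x Q = x -> tsum x = 0 -> x = fun=> 0.
Proof.
move=> hQ irr hx xQ x0; apply/funext => i.
have [h|h] := invariant_sign hQ irr hx xQ; first exact: tsum_eq0.
apply/eqP; rewrite -oppr_eq0; apply/eqP.
apply: (@tsum_eq0 _ _ (fun i => - x i)); first by move=> j; rewrite oppr_ge0.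
  exact: asumN.
by rewrite tsumN x0 oppr0.
Qed.

Lemma stationary_invariant Q x : is_stationary Q x ->
  [/\ asum x, tsum x = 1 & vecm x Q = x].
Proof. by move=> [/distribution_tsum[h1 h2] h3]. Qed.

Lemma stationary_unique Q x : is_transition_matrix Q -> irreducible_mc Q ->
  is_stationary Q x -> is_unique_stationary Q x.
Proof.
move=> hQ irr hx; split=> // y hy.
have [ax sx xQ] := stationary_invariant hx.
have [ay sy yQ] := stationary_invariant hy.
have h : (fun i => y i - x i) = fun=> 0.
  apply: (invariant_eq0 hQ irr); first exact: asumB.
  - by rewrite vecmB ?xQ ?yQ//; exact: transition_substochastic.
  - by rewrite tsumB// sx sy subrr.
apply/funext => i; apply/eqP; rewrite -subr_eq0; apply/eqP.
exact: (congr1 (fun f => f i) h).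
Qed.

(** Some entry is positive since the sum is 1, and irreducibility spreads positivity to all
    states. *)
Lemma stationary_gt0 Q x : is_transition_matrix Q -> irreducible_mc Q ->
  is_stationary Q x -> forall j, 0 < x j.
Proof.
move=> hQ irr hx j; have [ax sx xQ] := stationary_invariant hx.
have x0 : forall i, 0 <= x i by have [[]] := hx.
have [[i xi]|/forallNP xn] := pselect (exists i, 0 < x i).
  exact: (invariant_gt0 (transition_substochastic hQ) ax x0 xQ irr (i := i)).
suff x_eq0 : x = fun=> 0.
  by move: sx; rewrite x_eq0 tsum0 => /esym/eqP; rewrite oner_eq0.
by apply/funext => i; apply/eqP; rewrite eq_le x0 andbT leNgt; exact/negP/xn.
Qed.

Lemma distribution_intro x : (forall i, 0 <= x i) -> asum x -> tsum x = 1 ->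
  is_distribution x.
Proof. by move=> x0 hx x1; split=> //; rewrite -tsum_ge0E// x1. Qed.

End Invariant.

(** * Last-exit decomposition at the state [o] *)

Section Taboo.
Context {K : realType} {S : set nat}.
Variables (P : mat K S) (o : S).
Hypothesis hP : is_transition_matrix P.
Let T := taboo P o.
Let sP := transition_substochastic hP.

Lemma taboo_substochastic : substochastic T.
Proof.
have TP i j : 0 <= T i j <= P i j.
  by rewrite /T /taboo; case: ifP => _; rewrite ?lexx ?sP.1.
split=> [i j|i]; first by have /andP[] := TP i j.
have [h1 h2] := sP.2 i.
have hT : asum (T i).
  by apply: asum_le h1 => j; have /andP[? ?] := TP i j; rewrite ger0_norm.
split=> //; apply: le_trans h2; apply: ler_tsum => // j.
by have /andP[] := TP i j.
Qed.
Let sT := taboo_substochastic.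
Let sTn n := substochastic_powm n sT.
Let sPn n := substochastic_powm n sP.

Lemma taboo_col i : P i o = 1 - tsum (T i).
Proof.
have [h1 h2] := distribution_tsum (hP i).
have [h3 h4] := sT.2 i.
have [|h5 h6] := @asum_delta K S o (fun j => P i j - T i j).
  by move=> j /negbTE jo; rewrite /T /taboo jo subrr.
rewrite -h2 -tsumB// h6 /T /taboo eqxx subr0//.
Qed.

(** The exponent [n.+1] matters: the zeroth power is the identity and still charges [o] when started
    there. *)
Lemma powm_taboo_col n k : powm T n.+1 k o = 0.
Proof.
rewrite powmSr// /mulm (_ : (fun i => _) = fun=> 0) ?tsum0//.
by apply/funext => i; rewrite /T /taboo eqxx mulr0.
Qed.

(* Decomposition at the last visit to [o]; [tsum (powm T m k)] is the
   probability of avoiding [o] during the steps [1, ..., m] from [k]. *)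
Lemma last_exit_decomposition N k j :
  \sum_(0 <= n < N) powm P n k j - \sum_(0 <= n < N) powm P n o j =
  \sum_(0 <= n < N) powm T n k j -
  \sum_(0 <= m < N) tsum (powm T m k) * powm P (N - m.+1) o j.
Proof.
elim: N k => [|N IH] k; first by rewrite !big_nil !subrr.
(* First-step expansion, used for both [P] and [T]; the length [N.+1] splits off the identity
   term. *)
have step (A : mat K S) : substochastic A ->
    \sum_(0 <= n < N.+1) powm A n k j =
    idm k j + tsum (fun i => A k i * \sum_(0 <= n < N) powm A n i j) /\
    asum (fun i => A k i * \sum_(0 <= n < N) powm A n i j).
  move=> sA; rewrite big_nat_recl//=.
  have [|h1 h2] := tsum_sum N (F := fun n i => A k i * powm A n i j).
    move=> n; apply: vecm_asum; first by have [] := sA.2 k.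
    exact: substochastic_powm.
  by under [in tsum _]eq_fun do rewrite mulr_sumr; split;
    [rewrite h2|under eq_fun do rewrite mulr_sumr].
have [P1 P2] := step P sP; have [T1 T2] := step T sT.
have [|t1 t2] := tsum_sum N (F := fun m i =>
    T k i * (tsum (powm T m i) * powm P (N - m.+1) o j)).
  move=> m; apply: (@asumM _ _ _ _ 1); first by have [] := sT.2 k.
  move=> i; have [? ?] := (sTn m).2 i.
  rewrite normrM mulr_ile1// ?substochastic_le1//.
  by rewrite ger0_norm// tsum_ge0//; exact: (sTn m).1.
pose a := \sum_(0 <= n < N) powm P n o j.
pose W i := \sum_(0 <= n < N) powm P n i j - a.
have PW : tsum (fun i => P k i * W i) =
    tsum (fun i => P k i * \sum_(0 <= n < N) powm P n i j) - a.
  have [h1 h2] := distribution_tsum (hP k).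
  rewrite -[X in _ - X]mulr1 -h2 -tsumZ// -tsumB//; last exact: asumZ.
  by congr tsum; apply/funext => i; rewrite mulrBr [a * _]mulrC.
(* [W] vanishes at [o], so zeroing column [o] of [P] does not change the sum. *)
have PT : tsum (fun i => P k i * W i) = tsum (fun i => T k i * W i).
  congr tsum; apply/funext => i; rewrite /T /taboo; case: eqP => // ->.
  by rewrite /W subrr !mulr0.
have TW : tsum (fun i => T k i * W i) =
    tsum (fun i => T k i * \sum_(0 <= n < N) powm T n i j) -
    \sum_(0 <= m < N) tsum (powm T m.+1 k) * powm P (N - m.+1) o j.
  transitivity (tsum (fun i => T k i * \sum_(0 <= n < N) powm T n i j) -
    \sum_(0 <= m < N)
      tsum (fun i => T k i * (tsum (powm T m i) * powm P (N - m.+1) o j))).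
    rewrite -t2 -tsumB//; congr tsum; apply/funext => i.
    by rewrite /W /a IH mulrBr; congr (_ - _); rewrite mulr_sumr.
  congr (_ - _); apply: eq_bigr => m _.
  rewrite (tsum_vecm (proj1 (sT.2 k)) (sTn m)) mulrC -tsumZ.
    by congr tsum; apply/funext => i; rewrite mulrA mulrC.
  apply: (@asumM _ _ _ _ 1); first by have [] := sT.2 k.
  move=> i; have [? ?] := (sTn m).2 i.
  by rewrite ger0_norm// tsum_ge0//; exact: (sTn m).1.
rewrite P1 T1 [in X in _ - X]big_nat_recr//= -/a.
(* The term [m = 0] has weight [tsum (idm k) = 1] and matches the last term [powm P N o j] split off
   on the left. *)
rewrite [X in _ = _ - X]big_nat_recl//= tsum_idm subSS subn0 mul1r.
move: PW; rewrite PT TW => /eqP; rewrite eq_sym subr_eq => /eqP ->.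
under [in RHS]eq_bigr do rewrite subSS.
by ring.
Qed.

End Taboo.

Lemma cvg_sum_nat {K : realType} (f : nat -> nat -> K) (l : nat -> K) M :
  (forall m, f m @ \oo --> l m) ->
  (fun N => \sum_(0 <= m < M) f m N) @ \oo --> \sum_(0 <= m < M) l m.
Proof.
move=> fl; elim: M => [|M IH].
  by rewrite big_nil; under eq_fun do rewrite big_nil; exact: cvg_cst.
by rewrite big_nat_recr//=; under eq_fun do rewrite big_nat_recr//=; exact: cvgD.
Qed.

(** * Structure of the deviation matrix and its action on rows of sum 0 *)

Section Deviation.
Context {K : realType} {S : set nat}.
Variables (P : mat K S) (pi : rvec K S) (D : mat K S).
Hypothesis hP : is_transition_matrix P.
Hypothesis irrP : irreducible_mc P.
Hypothesis hpi : is_stationary P pi.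
Hypothesis hD : is_deviation_matrix P pi D.

(** The terms of the convergent deviation series tend to 0. *)
Lemma powm_cvg i j : (fun n => powm P n i j) @ \oo --> pi j.
Proof.
have : cvgn (series (fun k => subm (powm P k) (ergodic_projector pi) i j)).
  by apply/cvg_ex; exists (D i j); exact: hD.
move=> /cvg_series_cvg_0 h.
rewrite -[pi j]add0r; apply: cvg_trans (cvgD h (cvg_cst (pi j))).
by apply: near_eq_cvg; apply: nearW => n /=; rewrite /subm subrK.
Qed.

(** The ergodic projector has equal rows, so it cancels between rows [i] and [o]. *)
Lemma deviation_subr i o j :
  (fun N => \sum_(0 <= n < N) powm P n i j - \sum_(0 <= n < N) powm P n o j)
    @ \oo --> D i j - D o j.
Proof.
apply: cvg_trans (cvgB (@hD i j) (@hD o j)).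
apply: near_eq_cvg; apply: nearW => N; rewrite /series !fctE -!sumrB.
by apply: eq_bigr => n _; rewrite /subm opprB addrA subrK.
Qed.

Let sP := transition_substochastic hP.
Let sPn n := substochastic_powm n sP.

Section FixedState.
Variable o : S.
Let T := taboo P o.
Let sT := taboo_substochastic o hP.
Let sTn n := substochastic_powm n sT.
Let t k n := tsum (powm T n k).

Let t0 k n : 0 <= t k n.
Proof. by apply: tsum_ge0; [exact: (sTn n).1|have [] := (sTn n).2 k]. Qed.

(** In column [o] of the last-exit decomposition the taboo sum is at most 1. Keeping only the first
    [M] convolution terms and letting [N] tend to infinity bounds [series (t k) M * pi o] by
    [1 - (D k o - D o o)], uniformly in [M]. *)
Lemma hitting_time_cvg k : cvgn (series (t k)).
Proof.
have pi0 := stationary_gt0 hP irrP hpi o.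
have G1 N : \sum_(0 <= n < N) powm T n k o <= 1.
  case: N => [|N]; first by rewrite big_nil.
  rewrite big_nat_recl//= big1 ?addr0.
    by rewrite (le_trans (ler_norm _))// (substochastic_le1 (sTn 0)).
  by move=> n _; exact: powm_taboo_col.
apply: nondecreasing_is_cvgn; first by apply/nondecreasing_series.
exists ((1 - (D k o - D o o)) / pi o) => _ [M _ <-].
rewrite ler_pdivlMr//.
have hl : (fun N => \sum_(0 <= m < M) t k m * powm P (N - m.+1) o o) @ \oo -->
    series (t k) M * pi o.
  rewrite /series/= mulr_suml.
  apply: cvg_sum_nat => m; apply: cvgMr.
  by rewrite -(cvg_shiftn m.+1); under eq_fun do rewrite addnK; exact: powm_cvg.
have hr := cvgB (cvg_cst (1 : K)) (@deviation_subr k o o).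
apply: (ler_cvg_to hl (hr _ _)); exists M => // N /= MN.
rewrite !fctE (last_exit_decomposition o hP) opprB.
rewrite (big_cat_nat (n := M) (p := N))//=.
have : 0 <= \sum_(M <= m < N) t k m * powm P (N - m.+1) o o.
  by apply: sumr_ge0 => m _; rewrite mulr_ge0//; exact: (sPn _).1.
by have := G1 N; rewrite /t; lra.
Qed.

(** Limit of the last-exit decomposition: [cvg_convolution] applies to the summable survival
    probabilities [t k] and the convergent sequence [powm P n o j]. *)
Lemma taboo_potential_cvg k j : (fun N => \sum_(0 <= n < N) powm T n k j) @ \oo
   --> D k j - D o j + limn (series (t k)) * pi j.
Proof.
have hc := @cvg_convolution K (t k) (fun n => powm P n o j) _ _ 1 (t0 k)
  (@hitting_time_cvg k) (fun n => substochastic_le1 (sPn n) o j) (@powm_cvg o j).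
apply: cvg_trans (cvgD (@deviation_subr k o j) hc).
apply: near_eq_cvg; apply: nearW => N /=.
by rewrite !fctE (last_exit_decomposition o hP) subrK.
Qed.

Lemma taboo_potential_o k :
  (fun N => \sum_(0 <= n < N) powm T n k o) @ \oo --> (idm k o : K).
Proof.
rewrite -(cvg_shiftn 1).
apply: cvg_near_cst; apply: nearW => N.
rewrite /= ?addn1 big_nat_recl//= big1 ?addr0// => n _; exact: powm_taboo_col.
Qed.

End FixedState.

(* [G k j] is the expected number of visits to [j] from [k] strictly before
   [o] is hit (again, if [k = o]), and [m k] the expected hitting time. *)
Lemma deviation_decomposition (o : S) : exists (G : mat K S) (m : rvec K S),
  [/\ forall k j, 0 <= G k j,
      forall k, asum (G k) /\ tsum (G k) = m k,
      forall k l, tsum (fun j => G k j * P j l) = G k l - idm k l + (l == o)%:R,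
      forall k, G k o = idm k o &
      forall k j, D k j = D o j + G k j - m k * pi j].
Proof.
pose T := taboo P o.
pose sT := taboo_substochastic o hP.
pose sTn n := substochastic_powm n sT.
pose t k n := tsum (powm T n k).
pose m k := limn (series (t k)).
pose G k j := D k j - D o j + m k * pi j.
have cvt k : series (t k) @ \oo --> m k by exact: hitting_time_cvg.
have cvG k j : (fun N => \sum_(0 <= n < N) powm T n k j) @ \oo --> G k j.
  exact: taboo_potential_cvg.
have aT n k : asum (powm T n k) by have [] := (sTn n).2 k.
(* Monotone convergence: summing the taboo powers over [j] gives the series of [t k], whose limit is
   [m k]. *)
have hG k : [/\ forall j, 0 <= G k j, asum (G k) & tsum (G k) = m k].
  apply: (@tsum_series _ _ (fun n j => powm T n k j)).
  - by move=> n i; exact: (sTn n).1.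
  - by move=> n; exact: aT.
  - by move=> j; exact: cvG.
  - exact: cvt.
have Go k : G k o = idm k o.
  by apply: cvg_unique (cvG k o) (@taboo_potential_o o k).
exists G, m; split => //.
- by move=> k; have [] := hG k.
- by move=> k; have [_ ? ?] := hG k.
- move=> k l.
  suff [_ _ //] : [/\ forall j, 0 <= G k j * P j l,
      asum (fun j => G k j * P j l) &
      tsum (fun j => G k j * P j l) = G k l - idm k l + (l == o)%:R].
  apply: (@tsum_series _ _ (fun n j => powm T n k j * P j l)).
  + by move=> n i; rewrite mulr_ge0//; [exact: (sTn n).1|exact: sP.1].
  + by move=> n; exact: vecm_asum.
  + move=> j; rewrite (_ : series _ =
      (fun N => (\sum_(0 <= n < N) powm T n k j) * P j l)).
      by apply: cvgMl; exact: cvG.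
    by apply/funext => N; rewrite /series/= mulr_suml.
  (* For [l = o] the mass lost to [o] telescopes: the partial sums are [1 - t k N], and [t k N]
     tends to 0. The limit 1 is the indicator term, as [G k o = idm k o]. *)
  have [->|lo] := eqVneq l o.
    rewrite Go subrr add0r.
    have tn : t k @ \oo --> 0.
      by apply: cvg_series_cvg_0; apply/cvg_ex; exists (m k); exact: cvt.
    rewrite -[X in _ --> X]subr0.
    apply: cvg_trans (cvgB (cvg_cst (1 : K)) tn).
    apply: near_eq_cvg; apply: nearW => N /=; rewrite /series/=.
    have E n : tsum (fun j => powm T n k j * P j o) = t k n - t k n.+1.
      rewrite /t powmSr// mulm_row tsum_vecm// -tsumB//.
        congr tsum; apply/funext => j.
        by rewrite (taboo_col o hP) mulrBr mulr1.
      apply: (@asumM _ _ _ _ 1) => // j; have [? ?] := sT.2 j.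
      by rewrite ger0_norm// tsum_ge0//; exact: sT.1.
    under eq_bigr do rewrite E.
    rewrite (telescope_sumr_eq (fun n => - t k n))//; last first.
      by move=> i _; rewrite opprK addrC.
    by rewrite opprK /t tsum_idm addrC.
  (* For [l != o] column [l] of [P] and [T] agree, so the sum is the potential [G k l] without its
     identity term [n = 0]. *)
  rewrite addr0.
  have h := cvG k l; rewrite -(cvg_shiftn 1) in h.
  apply: cvg_trans (cvgB h (cvg_cst (idm k l))).
  apply: near_eq_cvg; apply: nearW => N /=.
  rewrite !fctE addn1 big_nat_recl//= addrC addKr /series/=.
  apply: eq_bigr => n _.
  rewrite -[mulm T _]/(powm T n.+1) powmSr// /mulm.
  congr tsum; apply/funext => j.
  by rewrite {2}/T /taboo (negbTE lo).
- by move=> k j; rewrite /G; ring.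
Qed.

(* [z D] is evaluated through [D k j - D o j], since [D o j] alone is not known
   to be summable in [j]; the assumption at the single column [o] bounds the
   expected hitting time of [o] under [|z|]. *)
Lemma vecm_deviation (z : rvec K S) (o : S) :
  asum z -> tsum z = 0 -> asum (fun k => z k * D k o) ->
  [/\ asum (vecm z D), tsum (vecm z D) = 0 &
      forall l, vecm z D l - vecm (vecm z D) P l = z l].
Proof.
move=> hz z0 hzD.
have [G [m [G0 Gm GP Go DE]]] := deviation_decomposition o.
have pi0 := stationary_gt0 hP irrP hpi o.
have [api spi piP] := stationary_invariant hpi.
have m0 k : 0 <= m k by have [? <-] := Gm k; exact: tsum_ge0.
(* Column [o] of [DE], with [G k o = idm k o], is solved for [m k] by dividing by [pi o > 0]. *)
have hzm : asum (fun k => z k * m k).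
  have -> : (fun k => z k * m k) = (fun k => (pi o)^-1 *
      (D o o * z k + z k * idm k o - z k * D k o)).
    apply/funext => k; rewrite (DE k o) Go; field; exact: lt0r_neq0.
  apply: asumZ; apply: asumB => //; apply: asumD; first exact: asumZ.
  exact: (vecm_asum hz (@substochastic_idm _ _)).
have Gle k j : `|z k * G k j| <= `|z k * m k|.
  rewrite !normrM ler_wpM2l// !ger0_norm//; have [? <-] := Gm k.
  exact: le_tsum_term.
have hzG j : asum (fun k => z k * G k j).
  by apply: asum_le (asum_norm hzm) => k; exact: Gle.
have F2 : asum2 (fun p => z p.1 * G p.1 p.2).
  apply: asum2_intro => /= [k|]; first by apply: asumZ; have [] := Gm k.
  apply: eq_asum (asum_norm hzm) => k; have [? h] := Gm k.
  under eq_fun do rewrite normrM [`|G _ _|]ger0_norm//.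
  by rewrite tsumZ// h normrM [`|m k|]ger0_norm.
pose w := vecm z G; pose c := tsum (fun k => z k * m k).
have [_ /= wc] := tsum_fubini F2.
have [aw _] := tsum_fubini (asum2_swap F2).
have {}aw : asum w by exact: aw.
have {}wc : tsum w = c.
  rewrite /w /vecm -wc; congr tsum; apply/funext => k; have [? h] := Gm k.
  by rewrite tsumZ// h.
(* The contribution of [D o j] is multiplied by the total mass of [z], which is 0. *)
have yE : vecm z D = (fun j => w j - c * pi j).
  apply/funext => j; rewrite /vecm.
  have -> : (fun i => z i * D i j) =
      (fun k => D o j * z k + (z k * G k j - pi j * (z k * m k))).
    by apply/funext => k; rewrite (DE k j); ring.
  have hB : asum (fun k => z k * G k j - pi j * (z k * m k)).
    by apply: asumB => //; exact: asumZ.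
  rewrite tsumD//; last exact: asumZ.
  rewrite tsumZ// z0 mulr0 add0r tsumB//; last exact: asumZ.
  by rewrite tsumZ// [pi j * _]mulrC.
have acpi : asum (fun j => c * pi j) by exact: asumZ.
(* Sum [GP] against [z]: the indicator of [o] again meets the total mass of [z] and disappears. *)
have wP l : vecm w P l = w l - z l.
  have F3 : asum2 (fun p : S * S => z p.1 * G p.1 p.2 * P p.2 l).
    apply: asum2_le F2 => p; rewrite normrM ler_piMr//.
    exact: substochastic_le1.
  have [_ /= E] := tsum_fubini F3.
  transitivity (tsum (fun j => tsum (fun k => z k * G k j * P j l))).
    congr tsum; apply/funext => j; rewrite mulrC /w /vecm -tsumZ//.
    by congr tsum; apply/funext => k; rewrite mulrC.
  rewrite -E.
  transitivity (tsum (fun k => (z k * G k l - z k * idm k l) + (l == o)%:R * z k)).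
    congr tsum; apply/funext => k.
    under eq_fun do rewrite -mulrA.
    rewrite tsumZ ?GP; first by ring.
    by apply: vecm_asum => //; have [] := Gm k.
  have hzi : asum (fun k => z k * idm k l).
    exact: (vecm_asum hz (@substochastic_idm _ _)).
  rewrite tsumD ?tsumZ ?z0 ?mulr0 ?addr0//; [|exact: asumB|exact: asumZ].
  rewrite tsumB//; congr (_ - _).
  exact: (congr1 (fun f => f l) (vecm_idm z)).
rewrite yE; split.
- exact: asumB.
- by rewrite tsumB// wc tsumZ// spi mulr1 subrr.
- move=> l; rewrite vecmB// wP.
  have -> : vecm (fun j => c * pi j) P l = c * pi l.
    rewrite -[in RHS]piP /vecm -tsumZ; last exact: vecm_asum.
    by congr tsum; apply/funext => i; rewrite mulrA.
  by ring.
Qed.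

End Deviation.

(** * The recursion between consecutive terms of the perturbation series *)

Section Perturbation.
Context {K : realType} {S : set nat}.
Variables (P R : mat K S) (pi : rvec K S) (D : mat K S).
Hypothesis hP : is_transition_matrix P.
Hypothesis hR : is_transition_matrix R.
Hypothesis irrP : irreducible_mc P.
Hypothesis hpi : is_stationary P pi.
Hypothesis hD : is_deviation_matrix P pi D.
Let sP := transition_substochastic hP.
Let sR := transition_substochastic hR.
Let Q := subm R P.

(** By Fubini the product rebrackets as [z D] with [z = x R - x P]. This [z] has sum 0 because [P]
    and [R] preserve sums, so [vecm_deviation] applies. *)
Lemma pert_step (x : rvec K S) (o : S) : asum x ->
  (forall j, asum2 (fun p : S * S => x p.1 * Q p.1 p.2 * D p.2 j)) ->
  [/\ asum (vecm x (mulm Q D)), tsum (vecm x (mulm Q D)) = 0 &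
      forall l, vecm x (mulm Q D) l - vecm (vecm x (mulm Q D)) P l =
        vecm x R l - vecm x P l].
Proof.
move=> hx hF.
pose z l := vecm x R l - vecm x P l.
have hxQ l : asum (fun i => x i * Q i l).
  apply: (@eq_asum _ _ (fun i => x i * R i l - x i * P i l)).
    by move=> i; rewrite -mulrBr.
  by apply: asumB; exact: vecm_asum.
have zE l : tsum (fun i => x i * Q i l) = z l.
  rewrite /z /vecm -tsumB; [|exact: vecm_asum..].
  by congr tsum; apply/funext => i; rewrite -mulrBr.
have hz : asum z by apply: asumB; exact: asum_vecm.
have z0 : tsum z = 0.
  rewrite tsumB; [|exact: asum_vecm..].
  by rewrite !tsum_vecm_transition// subrr.
have zD j k : tsum (fun i => x i * Q i k * D k j) = z k * D k j.
  rewrite -zE mulrC -tsumZ//.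
  by congr tsum; apply/funext => i; rewrite mulrC.
have hzD j : asum (fun k => z k * D k j).
  have [h _] := tsum_fubini (asum2_swap (hF j)).
  by apply: eq_asum h => k /=; exact: zD.
have yE : vecm x (mulm Q D) = vecm z D.
  apply/funext => j; have [_ /= h] := tsum_fubini (hF j).
  transitivity (tsum (fun k => tsum (fun i => x i * Q i k * D k j))); last first.
    by congr tsum; apply/funext => k; exact: zD.
  rewrite -h; congr tsum; apply/funext => i; rewrite /mulm.
  have hi := asum2_row i (hF j).
  rewrite (_ : (fun k => x i * Q i k * D k j) =
    (fun k => x i * (Q i k * D k j))); last first.
    by apply/funext => k; rewrite mulrA.
  (* Row [i] of the product is known to converge absolutely only after weighting by [x i]; dividing
     recovers it, and [x i = 0] is treated apart. *)
  have [->|xi] := eqVneq (x i) 0.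
    by rewrite mul0r; under eq_fun do rewrite mul0r; rewrite tsum0.
  rewrite tsumZ//; apply: eq_asum (asumZ (x i)^-1 hi) => k /=.
  by rewrite -mulrA mulKf.
by rewrite yE; exact: (vecm_deviation hP irrP hpi hD hz z0 (hzD o)).
Qed.

Lemma pert_term_step (x : rvec K S) (o : S) : asum x ->
  pert_terms_defined R P D x -> forall n,
  [/\ asum (pert_term R P D x n), tsum (pert_term R P D x n.+1) = 0 &
      forall l, pert_term R P D x n.+1 l - vecm (pert_term R P D x n.+1) P l =
        vecm (pert_term R P D x n) R l - vecm (pert_term R P D x n) P l].
Proof.
move=> hx hdef.
have ha n : asum (pert_term R P D x n).
  by elim: n => // n IH; have [] := pert_step o IH (hdef n).
by move=> n; have [_ ? ?] := pert_step o (ha n) (hdef n).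
Qed.

(** The total mass and each entry of the image under [A] change by at most the 1-norm of
    [x n - l]. *)
Lemma vecm_cvg (A : mat K S) (x : nat -> rvec K S) (l : rvec K S) :
  substochastic A -> (forall n, asum (x n)) -> asum l -> row_cvg x l ->
  (fun n => tsum (x n)) @ \oo --> tsum l /\
  forall j, (fun n => vecm (x n) A j) @ \oo --> vecm l A j.
Proof.
move=> sA hx hl xl.
have nE n : norm1 (fun i => x n i - l i) = (tsum (fun i => `|x n i - l i|))%:E.
  by rewrite tsum_ge0E//; exact/asum_norm/asumB.
have n0 : (fun n => tsum (fun i => `|x n i - l i|)) @ \oo --> 0.
  have /fine_cvgP[_ h] : norm1 (fun i => x n i - l i) @[n --> \oo] --> 0%:E := xl.
  by apply: cvg_trans h; apply: near_eq_cvg; apply: nearW => n /=; rewrite nE.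
have squeeze (f : nat -> K) c :
    (forall n, `|f n - c| <= tsum (fun i => `|x n i - l i|)) -> f @ \oo --> c.
  move=> fc; apply/cvgrPdist_le => e e0.
  move/cvgrPdist_le : n0 => /(_ _ e0); apply: filterS => n /=.
  rewrite sub0r normrN => h; rewrite distrC (le_trans (fc n))//.
  by rewrite (le_trans _ h)// ler_norm.
split=> [|j]; apply: squeeze => n.
  by rewrite -tsumB//; apply: ler_norm_tsum; exact: asumB.
have hd := asumB (hx n) hl.
rewrite -(congr1 (fun f => f j) (vecmB (hx n) hl sA)) /vecm.
apply: le_trans (ler_norm_tsum (vecm_asum hd sA j)) _.
apply: ler_tsum; [exact/asum_norm/vecm_asum|exact: asum_norm|] => i.
by rewrite normrM ler_piMr// substochastic_le1.
Qed.

End Perturbation.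

(** * Invariance and sign of the limit, uniqueness, and the bias term *)

Theorem theorem1 (K : realType) (S : set nat) (hS : state_space S)
    (alpha : K) (halpha : 1 <= alpha)
    (P R : mat K S)
    (hP : is_transition_matrix P) (hR : is_transition_matrix R)
    (hPirr : irreducible_mc P) (hPaper : aperiodic_mc P)
    (hPpos : positive_recurrent P)
    (piP : rvec K S) (hpiP : is_unique_stationary P piP)
    (D : mat K S) (hD : is_deviation_matrix P piP D)
    (mu : rvec K S) (hmu : is_pert_series R P D piP mu) :
  ((forall i, 0 <= mu i) -> is_stationary R mu)
  /\
  (forall nk : norm_kind,
     irreducible_mc R -> aperiodic_mc R ->
     (exists i, (mxnorm alpha nk (taboo R i) < 1)%E) ->
     is_unique_stationary R mu /\
     (forall piR : rvec K S, is_stationary R piR ->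
        pert_terms_defined R P D piR ->
        is_bias_term R P D piR (fun=> 0))).
Proof.
have [S0 _] := hS.
(* State 0 serves as the reference state of the last-exit decomposition. *)
pose o : S := exist _ 0%N (mem_set S0).
have sP := transition_substochastic hP.
have sR := transition_substochastic hR.
have stP := hpiP.1.
have [api spi piPE] := stationary_invariant stP.
have [hdef hcvg] := hmu.
pose y := pert_term R P D piP.
have yP n : [/\ asum (y n), tsum (y n.+1) = 0 & forall l,
    y n.+1 l - vecm (y n.+1) P l = vecm (y n) R l - vecm (y n) P l].
  exact: (pert_term_step hP hR hPirr stP hD o api hdef).
have ay n : asum (y n) by have [] := yP n.
pose s n : rvec K S := fun i => \sum_(0 <= k < n) y k i.
have as_ n : asum (s n) by have [] := tsum_sum n ay.
have amu : asum mu.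
  (* Convergence to 0 in the extended reals makes the 1-norms finite from some [N] on; [mu] is then
     a difference of two summable rows. *)
  have [N _ hN] : \forall n \near \oo, norm1 (fun i => s n i - mu i) \is a fin_num.
    by have /fine_cvgP[] : norm1 (fun i => s n i - mu i) @[n --> \oo] --> 0%:E
      := hcvg.
  have h : asum (fun i => s N i - mu i).
    by have := hN N (leqnn N); rewrite /asum summableE.
  by apply: eq_asum (asumB (as_ N) h) => i; rewrite subKr.
(* The term [y 0 = piP] has mass 1 and all later terms have mass 0; the empty sum [s 0] is
   excluded. *)
have s1 n : tsum (s n.+1) = 1.
  have [_ ->] := tsum_sum n.+1 ay.
  rewrite big_nat_recl//= big1 ?addr0//.
  by move=> k _; have [] := yP k.
have vecs A : substochastic A -> forall n l,
    vecm (s n) A l = \sum_(0 <= k < n) vecm (y k) A l.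
  move=> sA n l; rewrite /vecm.
  have [|_ <-] := tsum_sum n (F := fun k i => y k i * A i l).
    by move=> k; exact: vecm_asum.
  by congr tsum; apply/funext => i; rewrite mulr_suml.
(* The recursion is summed; the extra term [y 0 = piP] on the left contributes 0 by invariance under
   [P]. *)
have sE n l : s n.+1 l - vecm (s n.+1) P l = vecm (s n) R l - vecm (s n) P l.
  rewrite !vecs// /s -!sumrB big_nat_recl// (_ : y 0%N = piP)// piPE subrr add0r.
  by apply: eq_bigr => k _; have [_ _] := yP k.
have [mu1 muP] := vecm_cvg sP as_ amu hcvg.
have [_ muR] := vecm_cvg sR as_ amu hcvg.
have [_ mui] := vecm_cvg (@substochastic_idm _ _) as_ amu hcvg.
have smu : tsum mu = 1.
  rewrite -(cvg_shiftn 1) in mu1.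
  apply: cvg_unique mu1 _ => //; apply: cvg_near_cst; apply: nearW => n.
  by rewrite /= addn1 s1.
(* Both sides of [sE] converge; when the limits are equated, [vecm mu P] cancels. *)
have muRE : vecm mu R = mu.
  apply/funext => l.
  have h1 : (fun n => s (n + 1)%N l - vecm (s (n + 1)%N) P l) @ \oo -->
      mu l - vecm mu P l.
    rewrite (cvg_shiftn 1 (fun n => s n l - vecm (s n) P l)).
    apply: cvgB; last exact: muP.
    by have := mui l; rewrite vecm_idm; under eq_fun do rewrite vecm_idm.
  have h2 : (fun n => s (n + 1)%N l - vecm (s (n + 1)%N) P l) @ \oo -->
      vecm mu R l - vecm mu P l.
    rewrite (_ : (fun n => _) = (fun n => vecm (s n) R l - vecm (s n) P l)).
      by apply: cvgB; [exact: muR|exact: muP].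
    by apply/funext => n; rewrite addn1 sE.
  have /addIr// : vecm mu R l - vecm mu P l = mu l - vecm mu P l.
  by apply: cvg_unique h2 h1.
have part1 : (forall i, 0 <= mu i) -> is_stationary R mu.
  by move=> mu0; split=> //; exact: distribution_intro.
split=> // nk Rirr _ _.
have mu0 i : 0 <= mu i.
  have [//|mu0] := invariant_sign hR Rirr amu muRE.
  suff : tsum mu <= 0 by rewrite smu ler10.
  rewrite -(@tsum0 K S); apply: ler_tsum => //; exact: asum0.
have stR := stationary_unique hR Rirr (part1 mu0).
split=> // piR /stR.2 -> hdefR.
pose x := pert_term R P D mu.
have xP n : [/\ asum (x n), tsum (x n.+1) = 0 & forall l,
    x n.+1 l - vecm (x n.+1) P l = vecm (x n) R l - vecm (x n) P l].
  exact: (pert_term_step hP hR hPirr stP hD o amu hdefR).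
(* Since [mu] is invariant under [R], the rows [mu - s n] obey the same recursion as [x n]. Both
   sequences start at [mu] and have mass 0 afterwards, so at each step they differ by a
   [P]-invariant row of sum 0. *)
have xE n i : x n i = mu i - s n i.
  elim: n i => [|n IH] i; first by rewrite /s big_nil subr0.
  have [ax tx xnE] := xP n; have [ax1 _ _] := xP n.+1.
  have {}IH : x n = fun i => mu i - s n i by apply/funext => k; exact: IH.
  pose d := fun i => x n.+1 i - (mu i - s n.+1 i).
  have asn := as_ n; have asn1 := as_ n.+1; have ams := asumB amu asn1.
  have dE : d = fun=> 0.
    apply: (invariant_eq0 hP hPirr); first exact: asumB.
      rewrite /d (vecmB ax1 ams sP) (vecmB amu asn1 sP); apply/funext => l.
      have := xnE l; rewrite IH (vecmB amu asn sR) (vecmB amu asn sP) muRE.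
      by have := sE n l; lra.
    by rewrite /d (tsumB ax1 ams) (tsumB amu asn1) tx smu s1 !subrr.
  by have /eqP := congr1 (fun f => f i) dE; rewrite /d subr_eq0 => /eqP.
rewrite /is_bias_term /row_cvg.
rewrite (_ : (fun n => _) = (fun n => norm1 (fun i => s n i - mu i))) //.
apply/funext => n; apply: eq_esum => i _.
by rewrite -/(x n i) xE subr0 distrC.
Qed.
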